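(* Let $\{\Lambda_{x,j}: x\in\mathcal{X}, j\in J\}$ be a semi-continuous $g$-frame for a Hilbert space $\mathcal{H}$ with respect to a measure space $(\mathcal{X},\mu)$, with frame bounds $A$ and $B$. Suppose that $\Gamma_{x,j}\in\mathcal{L}(\mathcal{H},\mathcal{K}_{x,j})$ for any $x\in\mathcal{X}$, $j\in J$, and that there exist constants $\lambda_1,\lambda_2,\nu\ge0$ such that $\max(\lambda_1+\frac{\nu}{\sqrt A},\lambda_2)<1$ and $$\Big(\int_{\mathcal{X}}\sum_{j\in J}\|(\Lambda_{x,j}-\Gamma_{x,j})f\|^2d\mu(x)\Big)^{1/2}\le\lambda_1\Big(\int_{\mathcal{X}}\sum_{j\in J}\|\Lambda_{x,j}(f)\|^2d\mu(x)\Big)^{1/2}+\lambda_2\Big(\int_{\mathcal{X}}\sum_{j\in J}\|\Gamma_{x,j}(f)\|^2d\mu(x)\Big)^{1/2}+\nu\|f\|$$ for all $f\in\mathcal{H}$. Then $\{\Gamma_{x,j}: x\in\mathcal{X},j\in J\}$ is a semi-continuous $g$-frame for $\mathcal{H}$ with respect to $(\mathcal{X},\mu)$, with frame bounds $$A\Big(1-\frac{\lambda_1+\lambda_2+\frac{\nu}{\sqrt A}}{1+\lambda_2}\Big)^2,\qquad B\Big(1+\frac{\lambda_1+\lambda_2+\frac{\nu}{\sqrt B}}{1-\lambda_2}\Big)^2.$$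
   Context: $\mathcal{H},\mathcal{K}$ are Hilbert spaces, $J$ is a countable index set, $(\mathcal{X},\mu)$ is a measure space with positive measure $\mu$, $\{\mathcal{K}_{x,j}:x\in\mathcal{X},j\in J\}$ is a family of Hilbert spaces contained in $\mathcal{K}$, and $\mathcal{L}(\mathcal{H},\mathcal{K}_{x,j})$ is the collection of all bounded linear operators from $\mathcal{H}$ into $\mathcal{K}_{x,j}$. A family $\{\Lambda_{x,j}\in\mathcal{L}(\mathcal{H},\mathcal{K}_{x,j}):x\in\mathcal{X},j\in J\}$ is a semi-continuous $g$-frame for $\mathcal{H}$ with respect to $(\mathcal{X},\mu)$, with frame bounds $A,B>0$, if it is weakly-measurable, i.e., for every $f\in\mathcal{H}$ and $j\in J$ the function $x\mapsto\Lambda_{x,j}(f)$ is measurable on $\mathcal{X}$, and $A\|f\|^2\le\int_{\mathcal{X}}\sum_{j\in J}\|\Lambda_{x,j}(f)\|^2d\mu(x)\le B\|f\|^2$ for all $f\in\mathcal{H}$.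
   Formalization: The family Γ is additionally assumed to be weakly measurable, and the integral of the sum of ‖Γ_{x,j}(f)‖² is assumed finite for each f; without these assumptions the statement fails. *)

(* Defs.v *)
From HB Require Import structures.
From mathcomp Require Import all_boot all_order all_algebra.
From mathcomp Require Import sesquilinear complex.
From mathcomp Require Import all_classical all_reals all_analysis.

Set Implicit Arguments.
Unset Strict Implicit.
Unset Printing Implicit Defensive.

Import Order.TTheory GRing.Theory Num.Theory.
Import numFieldNormedType.Exports.

Local Open Scope classical_set_scope.
Local Open Scope ring_scope.

(* The Hilbert spaces are allowed to be real or complex. *)
Variant scalars := real_scalars | complex_scalars.

Definition scalar_field (R : realType) (k : scalars) : numFieldType :=
  match k with
  | real_scalars => R
  | complex_scalars => R[i]
  end.

Definition scalar_conj (R : realType) (k : scalars) : scalar_field R k -> scalar_field R k :=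
  match k with
  | real_scalars => idfun
  | complex_scalars => @conjc R
  end.

Definition scalar_re (R : realType) (k : scalars) : scalar_field R k -> R :=
  match k with
  | real_scalars => idfun
  | complex_scalars => @complex.Re R
  end.

HB.mixin Record hasInnerProduct (R : realType) (k : scalars) (V : Type)
    of CompleteNormedModule (scalar_field R k) V := {
  inner : {dot V for @scalar_conj R k};
  normr_inner : forall v : V, `|v| ^+ 2 = inner v v
}.

#[short(type="hilbertType")]
HB.structure Definition Hilbert (R : realType) (k : scalars) :=
  {V of CompleteNormedModule (scalar_field R k) V & hasInnerProduct R k V}.

(* The norm of a normed module over [R[i]] is [R[i]]-valued (with zero
   imaginary part); [hnorm] is its value in [R]. *)
Definition hnorm (R : realType) (k : scalars) (V : hilbertType R k) (v : V) : R :=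
  scalar_re `|v|.

(* A Hilbert space contained in [K], with the inherited inner product. *)
Definition closed_subspace (R : realType) (k : scalars) (K : hilbertType R k)
    (M : set K) : Prop :=
  submod_closed (mem M) /\ closed M.

Definition bounded_operators (R : realType) (k : scalars)
    (H K : hilbertType R k) (M : set K) : set {linear H -> K} :=
  [set T | bounded_near T (nbhs (0 : H)) /\ range T `<=` M].

(* Measurability with respect to the Borel sigma-algebra of [K]. *)
Definition weakly_measurable (R : realType) (k : scalars)
    (H K : hilbertType R k) (d : measure_display) (X : measurableType d)
    (J : Type) (L : X -> J -> {linear H -> K}) : Prop :=
  forall (f : H) (j : J),
    measurable_fun [set: X]
      (fun x : X => L x j f : g_sigma_algebraType (@open K)).

Definition sqnorm_integral (R : realType) (k : scalars)
    (H K : hilbertType R k) (d : measure_display) (X : measurableType d)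
    (mu : {measure set X -> \bar R}) (J : countType)
    (L : X -> J -> {linear H -> K}) (f : H) : \bar R :=
  (\int[mu]_x \esum_(j in [set: J]) (hnorm (L x j f) ^+ 2)%:E)%E.

Record semicontinuous_gframe (R : realType) (k : scalars)
    (H K : hilbertType R k) (d : measure_display) (X : measurableType d)
    (mu : {measure set X -> \bar R}) (J : countType) (Ks : X -> J -> set K)
    (L : X -> J -> {linear H -> K}) (A B : R) : Prop := SemicontinuousGframe {
  gframe_lower_gt0 : 0 < A;
  gframe_upper_gt0 : 0 < B;
  gframe_bounded : forall x j, bounded_operators (Ks x j) (L x j);
  gframe_measurable : weakly_measurable L;
  gframe_lower : forall f : H,
    ((A * hnorm f ^+ 2)%:E <= sqnorm_integral mu L f)%E;
  gframe_upper : forall f : H,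
    (sqnorm_integral mu L f <= (B * hnorm f ^+ 2)%:E)%E
}.

(* Main.v *)
(* Write |L| for the norm of x, j |-> L_{x,j} f in L^2(mu; l^2(J)).  The
   triangle inequality gives | |Lambda| - |Gamma| | <= |Lambda - Gamma|, which
   the hypothesis bounds by lambda1 |Lambda| + lambda2 |Gamma| + nu ||f||.
   Since sqrt A ||f|| <= |Lambda| <= sqrt B ||f||, solving for |Gamma| yields
   the frame bounds.
   When K is not separable, Lambda - Gamma need not be measurable, and its
   integral is then only a lower integral.  The triangle inequality survives
   because the pointwise norms p and q of Lambda and Gamma in l^2(J) are
   measurable and (p - q)^2 is a measurable minorant of the square of the
   pointwise norm of Lambda - Gamma. *)
Require Import Defs.
From HB Require Import structures.
From mathcomp Require Import all_boot all_order all_algebra.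
From mathcomp Require Import sesquilinear complex.
From mathcomp Require Import all_classical all_reals all_analysis.
From mathcomp Require Import measurable_realfun ring lra.

Set Implicit Arguments.
Unset Strict Implicit.
Unset Printing Implicit Defensive.

Import Order.TTheory GRing.Theory Num.Theory.
Import numFieldNormedType.Exports.

Local Open Scope classical_set_scope.
Local Open Scope ring_scope.

(** * Real parts and order, uniformly over real and complex scalars *)

Section scalar_field_theory.
Context {R : realType} {k : scalars}.
Implicit Types x y : scalar_field R k.

Definition scalar_of_real : R -> scalar_field R k :=
  match k with
  | real_scalars => idfun
  | complex_scalars => fun r => r%:C%C
  end.

Lemma scalar_of_realK : cancel scalar_of_real (@scalar_re R k).
Proof. by rewrite /scalar_of_real; case: k. Qed.

Lemma scalar_of_real_gt0 r : 0 < r -> 0 < scalar_of_real r.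
Proof. by rewrite /scalar_of_real; case: k => //= ?; rewrite ltcR. Qed.

Lemma scalar_reD x y : scalar_re (x + y) = scalar_re x + scalar_re y.
Proof. by move: x y; case: k => //= -[? ?] [? ?]. Qed.

Lemma scalar_re_le x y : x <= y -> scalar_re x <= scalar_re y.
Proof. by move: x y; case: k => //= x y; rewrite lecE => /andP[]. Qed.

Lemma scalar_re_lt x y : x < y -> scalar_re x < scalar_re y.
Proof. by move: x y; case: k => //= x y; rewrite ltcE => /andP[]. Qed.

End scalar_field_theory.

(** * The real-valued norm and its Borel measurability *)

Section hnorm_theory.
Context {R : realType} {k : scalars} {V : hilbertType R k}.
Implicit Types u v : V.

Lemma hnorm_ge0 v : 0 <= hnorm v.
Proof.
have := scalar_re_le (normr_ge0 v); congr (_ <= _).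
by rewrite -[LHS](addrK (@scalar_re R k 0)) -scalar_reD addr0 subrr.
Qed.

Lemma ler_hnormD u v : hnorm (u + v) <= hnorm u + hnorm v.
Proof. by rewrite -scalar_reD; apply/scalar_re_le/ler_normD. Qed.

Lemma hnormB u v : hnorm (u - v) = hnorm (v - u).
Proof. by rewrite /hnorm distrC. Qed.

Lemma open_hnorm_lt (a : R) : open [set v : V | hnorm v < a].
Proof.
rewrite openE => v /= va; rewrite /interior.
have e0 : 0 < a - hnorm v by rewrite subr_gt0.
(* Balls have radii in the scalar field, so the real gap is embedded there. *)
apply/nbhs_ballP; exists (scalar_of_real (a - hnorm v)).
  exact: scalar_of_real_gt0.
move=> u; rewrite -ball_normE /= => /scalar_re_lt.
rewrite scalar_of_realK -/(hnorm _) hnormB ltrBrDr => vu.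
by apply: le_lt_trans vu; rewrite -[in leLHS](subrK v u) ler_hnormD.
Qed.

Lemma measurable_hnorm :
  measurable_fun [set: g_sigma_algebraType (@open V)]
    (@hnorm R k V : g_sigma_algebraType (@open V) -> R).
Proof.
apply: (measurability _ (RGenInftyO.measurableE R)) => _ [_ [a ->] <-].
rewrite setTI; apply: sub_sigma_algebra.
rewrite (_ : _ @^-1` _ = [set v | hnorm v < a]); first exact: open_hnorm_lt.
by apply/seteqP; split => v; rewrite /= in_itv.
Qed.

End hnorm_theory.

(** Makes the linearity and measurability results for series over the naturals available for sums
    over [J]. A natural number that codes no index contributes 0. *)
Lemma esum_pickle (R : realType) (J : countType) (a : J -> \bar R) :
  (forall j, 0 <= a j)%E ->
  (\esum_(j in [set: J]) a j =
   \sum_(n <oo) oapp a 0 (pickle_inv n))%E.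
Proof.
move=> a0; rewrite nneseries_esumT; last by move=> n; case: pickle_inv.
transitivity (\esum_(n in range (@pickle J)) oapp a 0 (pickle_inv n))%E.
  rewrite esum_image; last by move=> i j _ _; exact: (pcan_inj pickleK_inv).
  by apply: eq_esum => j _; rewrite pickleK_inv.
rewrite esum_mkcond; apply: eq_esum => n _; case: ifPn => //.
rewrite notin_setE /=; case: pickle_inv (@pickle_invK J n) => //= j <-.
by case; exists j.
Qed.

(** * From Young's inequality to the triangle inequality *)

Lemma sqrD_le_young (R : realFieldType) (a b t : R) : 0 < t ->
  (a + b) ^+ 2 <= (1 + t) * a ^+ 2 + (1 + t^-1) * b ^+ 2.
Proof.
move=> t0; rewrite -subr_ge0.
suff -> : (1 + t) * a ^+ 2 + (1 + t^-1) * b ^+ 2 - (a + b) ^+ 2 =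
    t^-1 * (t * a - b) ^+ 2 by rewrite mulr_ge0 ?sqr_ge0// invr_ge0 ltW.
by field; rewrite gt_eqF.
Qed.

(** The optimal weight is t = u / s, which fails when s or u vanishes. Both are therefore shifted by
    a small d > 0. *)
Lemma le_sqrD_of_young (R : realFieldType) (p s u : R) : 0 <= s -> 0 <= u ->
  (forall t, 0 < t -> p <= (1 + t) * s ^+ 2 + (1 + t^-1) * u ^+ 2) ->
  p <= (s + u) ^+ 2.
Proof.
move=> s0 u0 young; apply/ler_addgt0Pr => e e0.
have su0 : 0 < s + u + 1 by lra.
(* With t = (u + d) / (s + d) the excess over (s + u)^2 is at most d (s + u), hence at most e; the 1
   keeps the denominator positive. *)
pose d := e / (s + u + 1).
have d0 : 0 < d by rewrite divr_gt0.
have sd0 : 0 < s + d by lra.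
have ud0 : 0 < u + d by lra.
have := young _ (divr_gt0 ud0 sd0); rewrite invf_div => /le_trans; apply.
have le_sud : (u + d) / (s + d) * s ^+ 2 <= (u + d) * s.
  rewrite -mulrA ler_wpM2l ?(ltW ud0)// mulrC ler_pdivrMr//; nra.
have le_usd : (s + d) / (u + d) * u ^+ 2 <= (s + d) * u.
  rewrite -mulrA ler_wpM2l ?(ltW sd0)// mulrC ler_pdivrMr//; nra.
have -> : e = d * (s + u + 1) by rewrite /d divfK ?gt_eqF.
nra.
Qed.

(** For fixed t the premise is linear in p, q and r, so it can be summed and integrated termwise.
    This gives the triangle inequality in l^2 and in L^2 alike. *)
Lemma sqrte_le_add_of_young (R : realType) (p q r : \bar R) :
  (0 <= p)%E -> (0 <= q)%E -> (0 <= r)%E ->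
  (forall t : R, 0 < t -> (p <= (1 + t)%:E * q + (1 + t^-1)%:E * r)%E) ->
  (sqrte p <= sqrte q + sqrte r)%E.
Proof.
move: q r => [q| |//] [r| |//] p0; rewrite ?leey//= !lee_fin => q0 r0 young.
(* For finite q and r, the instance t = 1 excludes p = +oo. *)
have := young 1 ltr01; rewrite -!EFinM -EFinD.
move: p p0 young => [p|//|//]; rewrite /= ?lee_fin => p0 young _.
rewrite -[leRHS]ger0_norm ?addr_ge0 ?sqrtr_ge0// -sqrtr_sqr.
apply/ler_wsqrtr/le_sqrD_of_young; rewrite ?sqrtr_ge0// => t t0.
by rewrite !sqr_sqrtr// -lee_fin EFinD !EFinM young.
Qed.

Lemma sqr_hnorm_young (R : realType) (k : scalars) (V : hilbertType R k)
    (u v : V) (t : R) : 0 < t ->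
  hnorm u ^+ 2 <= (1 + t) * hnorm v ^+ 2 + (1 + t^-1) * hnorm (u - v) ^+ 2.
Proof.
move=> t0; have := ler_hnormD v (u - v); rewrite addrC subrK => uv.
apply: (@le_trans _ _ ((hnorm v + hnorm (u - v)) ^+ 2)).
  by rewrite lerXn2r ?nnegrE ?addr_ge0 ?hnorm_ge0.
exact: sqrD_le_young.
Qed.

(** * The pointwise norm in l^2(J) *)

Section l2_norm.
Context {R : realType} {k : scalars} {V : hilbertType R k} {J : countType}.
Implicit Types a b : J -> V.

Definition sqnorm_sum a : \bar R :=
  (\esum_(j in [set: J]) (hnorm (a j) ^+ 2)%:E)%E.

Lemma sqnorm_sum_ge0 a : (0 <= sqnorm_sum a)%E.
Proof. by apply: esum_ge0 => j _; rewrite lee_fin sqr_ge0. Qed.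

Lemma sqnorm_sumE a :
  sqnorm_sum a =
    (\sum_(n <oo) oapp (fun j => (hnorm (a j) ^+ 2)%:E) 0 (pickle_inv n))%E.
Proof. by apply: esum_pickle => j; rewrite lee_fin sqr_ge0. Qed.

Lemma sqnorm_sum_young a b (t : R) : 0 < t ->
  (sqnorm_sum a <= (1 + t)%:E * sqnorm_sum b +
    (1 + t^-1)%:E * sqnorm_sum (fun j => a j - b j)%R)%E.
Proof.
move=> t0; have term_ge0 (c : J -> V) n :
    (0 <= oapp (fun j => (hnorm (c j) ^+ 2)%:E) 0 (pickle_inv n))%E.
  by case: pickle_inv => //= j; rewrite lee_fin sqr_ge0.
have ti0 : 0 < t^-1 by rewrite invr_gt0.
rewrite !sqnorm_sumE -!nneseriesZl// -nneseriesD; last 2 first.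
- by move=> n _ _; rewrite mule_ge0// lee_fin; lra.
- by move=> n _ _; rewrite mule_ge0// lee_fin; lra.
apply: lee_nneseries => n _ //.
case: pickle_inv => [j|] /=; last by rewrite !mule0 adde0.
by rewrite -!EFinM -EFinD lee_fin sqr_hnorm_young.
Qed.

Lemma sqrte_sqnorm_sumD a b :
  (sqrte (sqnorm_sum a) <=
   sqrte (sqnorm_sum b) + sqrte (sqnorm_sum (fun j => a j - b j)%R))%E.
Proof.
apply: sqrte_le_add_of_young; rewrite ?sqnorm_sum_ge0// => t.
exact: sqnorm_sum_young.
Qed.

Lemma sqnorm_sumB a b :
  sqnorm_sum (fun j => a j - b j) = sqnorm_sum (fun j => b j - a j).
Proof. by apply: eq_esum => j _; rewrite hnormB. Qed.

Lemma sqr_sqrt_sqnorm_sumB a b :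
  (((Num.sqrt (fine (sqnorm_sum a)) - Num.sqrt (fine (sqnorm_sum b))) ^+ 2)%:E
   <= sqnorm_sum (fun j => a j - b j)%R)%E.
Proof.
have := sqrte_sqnorm_sumD a b; have := sqrte_sqnorm_sumD b a.
rewrite sqnorm_sumB.
move: (sqnorm_sum_ge0 (fun j => a j - b j)).
case: (sqnorm_sum (fun j => a j - b j)) => [r r0| |//]; last first.
  by move=> *; rewrite leey.
(* As the difference has finite norm, the two sums are both finite or both +oo. In the second case
   [fine] sends both to 0 and the left side vanishes. *)
move: (sqnorm_sum_ge0 a) (sqnorm_sum_ge0 b).
case: (sqnorm_sum a) => [p p0| _|//]; case: (sqnorm_sum b) => [q q0| _|//] //=;
  rewrite ?lee_fin ?sqrtr0 ?subrr ?expr0n//.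
rewrite !lee_fin in p0 q0 r0.
move=> ba ab.
rewrite -[leRHS]sqr_sqrtr// -real_normK ?num_real//.
rewrite lerXn2r ?nnegrE ?sqrtr_ge0// ler_norml; apply/andP; split; lra.
Qed.

End l2_norm.

(** * The triangle inequality for integrals *)

Section integral.
Context {R : realType} d (X : measurableType d).
Context (mu : {measure set X -> \bar R}).
Local Open Scope ereal_scope.

(* The integral of a nonnegative function, measurable or not, is a supremum
   over the simple functions below it. *)
Lemma ge0_le_integralT (f g : X -> \bar R) :
  (forall x, 0 <= f x) -> (forall x, f x <= g x) ->
  \int[mu]_x f x <= \int[mu]_x g x.
Proof.
move=> f0 fg; rewrite !ge0_integralTE//; last first.
  by move=> x; exact: le_trans (fg x).
apply: le_ereal_sup => _ [h hf <-]; exists h => // x.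
exact: le_trans (fg x).
Qed.

(** A finite integral makes f finite almost everywhere, so [fine] alters it only on a null set. *)
Lemma integral_fine (f : X -> \bar R) :
  measurable_fun [set: X] f -> (forall x, 0 <= f x) -> \int[mu]_x f x < +oo ->
  \int[mu]_x (fine (f x))%:E = \int[mu]_x f x.
Proof.
move=> mf f0 foo; have fi : mu.-integrable [set: X] f.
  by apply/integrableP; split=> //; under eq_integral do rewrite gee0_abs//.
apply: ge0_ae_eq_integral => //.
- by apply/measurable_EFinP; exact: measurableT_comp.
- by move=> x _; rewrite lee_fin fine_ge0.
- apply: filterS (integrable_ae measurableT fi) => x /= fx _.
  by rewrite fineK// fx.
Qed.

(** Additivity of the integral is applied only to measurable functions: f, g and the minorant [s] of
    h. The function h itself enters by monotonicity alone. *)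
Lemma sqrte_integral_triangle (f g h : X -> \bar R) :
  measurable_fun [set: X] f -> (forall x, 0 <= f x) -> \int[mu]_x f x < +oo ->
  measurable_fun [set: X] g -> (forall x, 0 <= g x) -> \int[mu]_x g x < +oo ->
  (forall x,
    ((Num.sqrt (fine (f x)) - Num.sqrt (fine (g x))) ^+ 2)%:E <= h x) ->
  sqrte (\int[mu]_x f x) <= sqrte (\int[mu]_x g x) + sqrte (\int[mu]_x h x).
Proof.
move=> mf f0 foo mg g0 goo fgh.
pose s x := ((Num.sqrt (fine (f x)) - Num.sqrt (fine (g x))) ^+ 2)%R.
have s0 x : 0 <= (s x)%:E by rewrite lee_fin sqr_ge0.
have msqrt (u : X -> \bar R) : measurable_fun [set: X] u ->
    measurable_fun [set: X] (fun x => Num.sqrt (fine (u x))).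
  move=> umeas; have msq : measurable_fun [set: R] (@Num.sqrt R).
    exact: (continuous_measurable_fun (@sqrt_continuous R)).
  by apply: (measurableT_comp msq); exact: measurableT_comp.
have ms : measurable_fun [set: X] (EFin \o s).
  apply/measurable_EFinP; apply: measurable_funX.
  by apply: measurable_funB; exact: msqrt.
have mfine (u : X -> \bar R) : measurable_fun [set: X] u ->
    measurable_fun [set: X] (fun x => (fine (u x))%:E).
  by move=> umeas; apply/measurable_EFinP; exact: measurableT_comp.
have le_sh : \int[mu]_x (s x)%:E <= \int[mu]_x h x by exact: ge0_le_integralT.
apply: sqrte_le_add_of_young; rewrite ?integral_ge0//.
  by move=> x _; exact: le_trans (s0 x) (fgh x).
move=> t t0; have ti0 : (0 < t^-1)%R by rewrite invr_gt0.
have t1 : (0 <= 1 + t)%R by lra.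
have t2 : (0 <= 1 + t^-1)%R by lra.
apply: (@le_trans _ _ ((1 + t)%:E * \int[mu]_x g x +
    (1 + t^-1)%:E * \int[mu]_x (s x)%:E)); last first.
  by rewrite leeD2l// lee_wpmul2l// lee_fin.
rewrite -(integral_fine mf)// -(integral_fine mg)//.
have gf0 x : 0 <= (fine (g x))%:E by rewrite lee_fin fine_ge0.
rewrite -!ge0_integralZl//; [|exact: mfine].
rewrite -ge0_integralD//; first last.
- by apply: measurable_funeM.
- by move=> x _; rewrite mule_ge0.
- by apply: measurable_funeM; exact: mfine.
- by move=> x _; rewrite mule_ge0.
apply: ge0_le_integralT => x; first by rewrite lee_fin fine_ge0.
rewrite -!EFinM -EFinD lee_fin /s.
rewrite -[X in (X <= _)%R](sqr_sqrtr (fine_ge0 (f0 x))).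
rewrite -[X in (_ <= _ * X + _)%R](sqr_sqrtr (fine_ge0 (g0 x))).
set p := Num.sqrt (fine (f x)); set q := Num.sqrt (fine (g x)).
(* Young's inequality for p = q + (p - q). *)
by rewrite -[in leLHS](subrK q p) [in leLHS]addrC sqrD_le_young.
Qed.

End integral.

(** * The triangle inequality for families of operators *)

Section perturbation.
Context {R : realType} {k : scalars} {H K : hilbertType R k}.
Context d (X : measurableType d) (mu : {measure set X -> \bar R}).
Context (J : countType).
Implicit Types L : X -> J -> {linear H -> K}.

Lemma measurable_sqnorm_sum L (f : H) : weakly_measurable L ->
  measurable_fun [set: X] (fun x => sqnorm_sum (fun j => L x j f)).
Proof.
move=> mL; under eq_fun do rewrite sqnorm_sumE.
apply: ge0_emeasurable_sum => [n x _ _|n _].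
  by case: pickle_inv => //= j; rewrite lee_fin sqr_ge0.
case: pickle_inv => [j|] /=; last exact: measurable_cst.
apply/measurable_EFinP; apply: measurable_funX.
exact: (measurableT_comp measurable_hnorm (mL f j)).
Qed.

Lemma sqnorm_integral_ge0 L (f : H) : (0 <= sqnorm_integral mu L f)%E.
Proof. by apply: integral_ge0 => x _; exact: sqnorm_sum_ge0. Qed.

(** [D] is tied to L - L' through norms only, so that the single family Lambda - Gamma serves for
    both orders of the two frames. *)
Lemma sqnorm_integral_triangle L L' (D : X -> J -> {linear H -> K}) (f : H) :
  (forall x j, hnorm (D x j f) = hnorm (L x j f - L' x j f)) ->
  weakly_measurable L -> weakly_measurable L' ->
  (sqnorm_integral mu L f < +oo)%E -> (sqnorm_integral mu L' f < +oo)%E ->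
  (sqrte (sqnorm_integral mu L f) <=
   sqrte (sqnorm_integral mu L' f) + sqrte (sqnorm_integral mu D f))%E.
Proof.
move=> DE mL mL' Loo L'oo; apply: sqrte_integral_triangle => //.
- exact: measurable_sqnorm_sum.
- by move=> x; exact: sqnorm_sum_ge0.
- exact: measurable_sqnorm_sum.
- by move=> x; exact: sqnorm_sum_ge0.
- move=> x; apply: le_trans (sqr_sqrt_sqnorm_sumB _ _) _.
  by apply: le_esum => j _; rewrite DE.
Qed.

End perturbation.

(** * The perturbation theorem *)

Theorem theorem4p2 (R : realType) (k : scalars) (H K : hilbertType R k)
  (d : measure_display) (X : measurableType d) (mu : {measure set X -> \bar R})
  (J : countType) (Ks : X -> J -> set K)
  (hKs : forall x j, closed_subspace (Ks x j))
  (Lambda Gamma : X -> J -> {linear H -> K}) (A B : R)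
  (hLambda : semicontinuous_gframe mu Ks Lambda A B)
  (hGamma : forall x j, bounded_operators (Ks x j) (Gamma x j))
  (* needed for the integrals and square roots below to be meaningful
     real numbers *)
  (mGamma : weakly_measurable Gamma)
  (finGamma : forall f : H, (sqnorm_integral mu Gamma f < +oo)%E)
  (lambda1 lambda2 nu : R)
  (hlambda1 : 0 <= lambda1) (hlambda2 : 0 <= lambda2) (hnu : 0 <= nu)
  (hmax : Num.max (lambda1 + nu / Num.sqrt A) lambda2 < 1)
  (hpert : forall f : H,
    (sqrte (sqnorm_integral mu
        (fun x j => (Lambda x j \- Gamma x j)%R : {linear H -> K}) f) <=
     lambda1%:E * sqrte (sqnorm_integral mu Lambda f) +
     lambda2%:E * sqrte (sqnorm_integral mu Gamma f) +
     (nu * hnorm f)%:E)%E) :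
  semicontinuous_gframe mu Ks Gamma
    (A * (1 - (lambda1 + lambda2 + nu / Num.sqrt A) / (1 + lambda2)) ^+ 2)
    (B * (1 + (lambda1 + lambda2 + nu / Num.sqrt B) / (1 - lambda2)) ^+ 2).
Proof.
have [A0 B0 _ mLambda lowerL upperL] := hLambda.
have sA0 : 0 < Num.sqrt A by rewrite sqrtr_gt0.
have sB0 : 0 < Num.sqrt B by rewrite sqrtr_gt0.
have [lambda1nu lambda21] : lambda1 + nu / Num.sqrt A < 1 /\ lambda2 < 1.
  by apply/andP; rewrite -gt_max.
have nuA0 : 0 <= nu / Num.sqrt A by rewrite divr_ge0// ltW.
have nuB0 : 0 <= nu / Num.sqrt B by rewrite divr_ge0// ltW.
(* Over a common denominator lambda2 cancels from the numerators, and both factors are visibly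
   positive. *)
have lower_factorE : 1 - (lambda1 + lambda2 + nu / Num.sqrt A) / (1 + lambda2) =
    (1 - (lambda1 + nu / Num.sqrt A)) / (1 + lambda2).
  by field; rewrite !gt_eqF//; lra.
have upper_factorE : 1 + (lambda1 + lambda2 + nu / Num.sqrt B) / (1 - lambda2) =
    (1 + lambda1 + nu / Num.sqrt B) / (1 - lambda2).
  by field; rewrite !gt_eqF//; lra.
rewrite lower_factorE upper_factorE.
set a_ := (1 - _) / _; set b_ := _ / (1 - _).
have a_gt0 : 0 < a_ by rewrite divr_gt0//; lra.
have b_gt0 : 0 < b_ by rewrite divr_gt0//; lra.
have bounds (f : H) : exists2 g : R, sqnorm_integral mu Gamma f = (g ^+ 2)%:E &
    Num.sqrt A * a_ * hnorm f <= g <= Num.sqrt B * b_ * hnorm f.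
  have n0 := hnorm_ge0 f.
  have Loo : (sqnorm_integral mu Lambda f < +oo)%E.
    exact: le_lt_trans (upperL f) (ltry _).
  pose LamGam x j : {linear H -> K} := (Lambda x j \- Gamma x j)%R.
  have GL := sqnorm_integral_triangle (D := LamGam)
    (fun x j => hnormB (Lambda x j f) (Gamma x j f))
    mGamma mLambda (finGamma f) Loo.
  have LG := sqnorm_integral_triangle (D := LamGam)
    (fun x j => erefl (hnorm (Lambda x j f - Gamma x j f)))
    mLambda mGamma Loo (finGamma f).
  move: (hpert f) LG GL (lowerL f) (upperL f); rewrite -/LamGam.
  have D0 := sqnorm_integral_ge0 mu LamGam f.
  move: D0 Loo (finGamma f).
  move: (sqnorm_integral_ge0 mu Lambda f) (sqnorm_integral_ge0 mu Gamma f).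
  set D := sqnorm_integral mu LamGam f => + + D0.
  case: (sqnorm_integral mu Lambda f) => [l l0 + _|//|//].
  case: (sqnorm_integral mu Gamma f) => [g g0 _|//|//].
  (* The right side of [hpert] is now finite, so [D] cannot be +oo. *)
  case: D D0 => [r r0|_ /=|//]; last by rewrite leye_eq.
  rewrite /= !lee_fin in l0 g0 r0 *.
  move=> pert LG GL lowL upL.
  exists (Num.sqrt g); first by rewrite sqr_sqrtr.
  have nE : Num.sqrt (hnorm f ^+ 2) = hnorm f by rewrite sqrtr_sqr ger0_norm.
  have lowL' : Num.sqrt A * hnorm f <= Num.sqrt l.
    by rewrite -nE -sqrtrM ?(ltW A0)// ler_wsqrtr.
  have upL' : Num.sqrt l <= Num.sqrt B * hnorm f.
    by rewrite -nE -sqrtrM ?(ltW B0)// ler_wsqrtr.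
  (* The term nu ||f|| is absorbed into |Lambda| for the lower bound and into sqrt B ||f|| for the
     upper one. *)
  have nu_l : nu * hnorm f <= nu / Num.sqrt A * Num.sqrt l.
    rewrite -mulrA ler_wpM2l// mulrC ler_pdivlMr// mulrC//.
  have nu_B : nu * hnorm f = nu / Num.sqrt B * (Num.sqrt B * hnorm f).
    by field; rewrite gt_eqF.
  apply/andP; split.
    (* [LG] and [pert] give (1 - lambda1 - nu / sqrt A) |Lambda| <= (1 + lambda2) |Gamma|; then
       [lowL'] applies. *)
    rewrite /a_ mulrA mulrAC ler_pdivrMr; last lra.
    nra.
  (* [GL] and [pert] give (1 - lambda2) |Gamma| <= (1 + lambda1) |Lambda| + nu ||f||; then [upL']
     applies. *)
  rewrite /b_ mulrA mulrAC ler_pdivlMr; last lra.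
  nra.
have lower_ge0 (f : H) : 0 <= Num.sqrt A * a_ * hnorm f.
  by rewrite mulr_ge0 ?hnorm_ge0// mulr_ge0 ?sqrtr_ge0 ?(ltW a_gt0).
have upper_ge0 (f : H) : 0 <= Num.sqrt B * b_ * hnorm f.
  by rewrite mulr_ge0 ?hnorm_ge0// mulr_ge0 ?sqrtr_ge0 ?(ltW b_gt0).
split=> //.
- by rewrite mulr_gt0// exprn_gt0.
- by rewrite mulr_gt0// exprn_gt0.
- move=> f; have [g -> /andP[lo _]] := bounds f.
  rewrite lee_fin -{1}(sqr_sqrtr (ltW A0)) -!exprMn.
  by rewrite lerXn2r ?nnegrE// (le_trans _ lo).
- move=> f; have [g -> /andP[lo up]] := bounds f.
  rewrite lee_fin -{1}(sqr_sqrtr (ltW B0)) -!exprMn.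
  by rewrite lerXn2r ?nnegrE// (le_trans _ lo).
Qed.
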